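(* If $G$ is a tree, then the defining ideal $J$ of $\mathcal{R}(I_c(G))$ has a quadratic Gröbner basis with respect to some monomial order on $T$. In particular, $\mathcal{R}(I_c(G))$ is Koszul.
   Context: Let $K$ be a field, let $G$ be a finite simple graph with vertex set $V(G)=[n]=\{1,\dots,n\}$ and edge set $E(G)=\{e_1,\dots,e_m\}$, and let $S=K[x_1,\dots,x_n]$. For each $i$, write $e_i=\{p,q\}$ and put $u_i=(x_1\cdots x_n)/(x_px_q)$. The complementary edge ideal of $G$ is $I_c(G)=(u_1,\dots,u_m)\subset S$, and its Rees algebra is $\mathcal{R}(I_c(G))=\bigoplus_{k\ge 0}I_c(G)^kt^k\subset S[t]$. Let $T=S[y_1,\dots,y_m]=K[x_1,\dots,x_n,y_1,\dots,y_m]$, let $\varphi:T\to\mathcal{R}(I_c(G))$ be the $S$-algebra homomorphism with $\varphi(y_i)=u_it$ for $i=1,\dots,m$, and let $J=\ker\varphi$. All variables of $T$ have degree $1$; a Gröbner basis is quadratic if it consists of polynomials of degree $2$. $\mathcal{R}(I_c(G))\cong T/J$ is regarded as a standard graded $K$-algebra with $x_1,\dots,x_n,u_1t,\dots,u_mt$ in degree $1$; Koszulness (the residue field $K$ has a linear graded free resolution over the algebra) is with respect to this grading. *)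

(* Defs.v *)
From HB Require Import structures.
From mathcomp Require Import all_boot all_order all_algebra.
From mathcomp Require Import boolp.
From mathcomp Require Import mpoly.

Set Implicit Arguments.
Unset Strict Implicit.
Unset Printing Implicit Defensive.

Import GRing.Theory.
Local Open Scope ring_scope.

Record sgraph (n m : nat) := SGraph {
  edge :> 'I_m -> {set 'I_n};
  edge_inj : injective edge;
  edge_card : forall i, #|edge i| = 2%N
}.

Definition adj n m (G : sgraph n m) : rel 'I_n :=
  fun p q => [exists i, G i == [set p; q]].

Definition is_tree n m (G : sgraph n m) : Prop :=
  [/\ (0 < n)%N,
      forall p q : 'I_n, connect (adj G) p q
    & forall c : seq 'I_n, (2 < size c)%N -> ~ ucycle (adj G) c].

Section Ideals.
Variable R : comNzRingType.
Implicit Types (X I : R -> Prop) (f g : R) (p q : {poly R}).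

Definition ideal_gen X f : Prop :=
  exists2 s : seq (R * R),
    forall z, z \in s -> X z.2 & f = \sum_(z <- s) z.1 * z.2.

Definition ideal_pow I (k : nat) : R -> Prop :=
  ideal_gen (fun f => exists2 s : k.-tuple R,
    forall x, x \in s -> I x & f = \prod_(x <- s) x).

Lemma ideal_gen0 X : ideal_gen X 0.
Proof. by exists [::] => //; rewrite big_nil. Qed.

Lemma ideal_genD X f g : ideal_gen X f -> ideal_gen X g -> ideal_gen X (f + g).
Proof.
move=> [s Xs ->] [t Xt ->]; exists (s ++ t); last by rewrite big_cat.
by move=> z; rewrite mem_cat => /orP[/Xs|/Xt].
Qed.

Lemma ideal_genM X f g : ideal_gen X g -> ideal_gen X (f * g).
Proof.
move=> [s Xs ->]; exists [seq (f * z.1, z.2) | z <- s].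
  by move=> _ /mapP[z /Xs Xp ->].
by rewrite big_map mulr_sumr; apply: eq_bigr => z _; rewrite mulrA.
Qed.

Lemma ideal_gen_sub X f : X f -> ideal_gen X f.
Proof.
move=> Xf; exists [:: (1, f)]; last by rewrite big_seq1 mul1r.
by move=> z; rewrite inE => /eqP->.
Qed.

Lemma ideal_gen_sum X (T : Type) (r : seq T) (P : pred T) (F : T -> R) :
  (forall i, P i -> ideal_gen X (F i)) ->
  ideal_gen X (\sum_(i <- r | P i) F i).
Proof. by move=> XF; elim/big_ind: _ => //; [exact: ideal_gen0 | exact: ideal_genD]. Qed.

Lemma ideal_pow0 I f : ideal_pow I 0 f.
Proof.
rewrite -[f]mulr1; apply/ideal_genM/ideal_gen_sub.
by exists [tuple] => //; rewrite big_nil.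
Qed.

Lemma ideal_powM I j k f g :
  ideal_pow I j f -> ideal_pow I k g -> ideal_pow I (j + k) (f * g).
Proof.
move=> [s Is ->] Ig; rewrite mulr_suml big_seq.
apply: ideal_gen_sum => -[a x] /Is /= [u Iu ->]; rewrite -mulrA.
apply: ideal_genM; case: Ig => [t It ->]; rewrite mulr_sumr big_seq.
apply: ideal_gen_sum => -[b y] /It /= [v Iv ->]; rewrite mulrCA.
apply/ideal_genM/ideal_gen_sub; exists [tuple of u ++ v]; last by rewrite big_cat.
by move=> z; rewrite mem_cat => /orP[/Iu|/Iv].
Qed.

Definition rees_pred I : {pred {poly R}} :=
  fun p => `[< forall k, ideal_pow I k p`_k >].

Lemma rees_predP I p :
  reflect (forall k, ideal_pow I k p`_k) (p \in rees_pred I).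
Proof. exact: asboolP. Qed.

Lemma rees_subring_closed I : subring_closed (rees_pred I).
Proof.
split.
- apply/rees_predP => -[|k]; first exact: ideal_pow0.
  by rewrite coef1; apply: ideal_gen0.
- move=> p q /rees_predP Ip /rees_predP Iq; apply/rees_predP => k.
  by rewrite coefB -mulN1r; exact: ideal_genD (Ip k) (ideal_genM _ (Iq k)).
- move=> p q /rees_predP Ip /rees_predP Iq; apply/rees_predP => k.
  rewrite coefM; apply: ideal_gen_sum => i _.
  by have := ideal_powM (Ip i) (Iq (k - i)%N); rewrite subnKC ?leq_ord.
Qed.

HB.instance Definition _ I :=
  GRing.isSubringClosed.Build {poly R} (rees_pred I) (rees_subring_closed I).

Record rees I := Rees { rees_val : {poly R}; _ : rees_val \in rees_pred I }.

HB.instance Definition _ I := [isSub for @rees_val I].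
HB.instance Definition _ I := [Choice of rees I by <:].
HB.instance Definition _ I := [SubChoice_isSubComNzRing of rees I by <:].

End Ideals.

(* The order is given in its reflexive form r a b <-> a <= b. *)
Definition monomial_order k (r : rel 'X_{1..k}) : Prop :=
  [/\ total r, antisymmetric r, transitive r,
      forall a, r 0%MM a
    & forall a b c, r a b -> r (a + c)%MM (b + c)%MM].

Section Groebner.
Variables (K : fieldType) (k : nat) (r : rel 'X_{1..k}).

(* The exponent of the initial monomial of f; the zero exponent is the neutral
   element of the maximum, being the least one for a monomial order. *)
Definition inm (f : {mpoly K[k]}) : 'X_{1..k} :=
  \big[(fun a b => if r a b then b else a)/0%MM]_(a <- msupp f) a.

Lemma inm_supp f : f != 0 -> monomial_order r -> inm f \in msupp f.
Proof.
rewrite -msupp_eq0 /inm => fn0 [_ anti _ min _].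
have: forall s : seq 'X_{1..k}, s != [::] ->
  \big[(fun a b => if r a b then b else a)/0%MM]_(a <- s) a \in s; last exact.
elim=> // a [|b s] IHs _; rewrite big_cons.
  by rewrite big_nil; case: ifP => [ra0|_]; rewrite mem_seq1 //; apply/eqP/anti; rewrite min.
by case: ifP => _; [rewrite inE IHs ?orbT | exact: mem_head].
Qed.

Lemma inm_max f a : monomial_order r -> a \in msupp f -> r a (inm f).
Proof.
move=> [tot _ trans _ _]; rewrite /inm.
elim: (msupp f : seq _) => // b s IHs; rewrite inE big_cons => /predU1P[->|/IHs].
  by case: ifP => // _; have := tot b b; rewrite orbb.
move: (bigop.body _ _ _) => c rac; case: ifP => // nrbc.
by apply: trans rac _; have := tot b c; rewrite nrbc.
Qed.

Definition in_monomials (I : {mpoly K[k]} -> Prop) (p : {mpoly K[k]}) : Prop :=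
  exists f, [/\ I f, f != 0 & p = 'X_[inm f]].

Definition initial_ideal (I : {mpoly K[k]} -> Prop) : {mpoly K[k]} -> Prop :=
  ideal_gen (in_monomials I).

Definition groebner_basis (I : {mpoly K[k]} -> Prop) (gs : seq {mpoly K[k]}) :=
  (forall g, g \in gs -> I g /\ g != 0) /\
  (forall p, initial_ideal I p <-> ideal_gen (in_monomials (fun g => g \in gs)) p).

(* [msize g] is one more than the degree of a nonzero g. *)
Definition has_quadratic_groebner_basis (I : {mpoly K[k]} -> Prop) : Prop :=
  exists2 gs, groebner_basis I gs & forall g, g \in gs -> msize g = 3%N.

End Groebner.

Section Koszul.
Variables (A : comNzRingType) (gr : nat -> A -> Prop).

(* The ideal of A spanned by the graded pieces [gr d] of positive degree. *)
Definition irrelevant (a : A) : Prop :=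
  exists N (c : nat -> A),
    (forall d, gr d.+1 (c d)) /\ a = \sum_(d < N) c d.

(* Graded free resolutions of the residue field A / A_+ of the form
     ... -> A(-2)^(b 2) -> A(-1)^(b 1) -> A^(b 0) -> A / A_+ -> 0.
   Free modules consist of row vectors, with matrices acting on the right. A
   degree-preserving map A(-i-1)^p -> A(-i)^q is a matrix of elements of degree
   1, and a degree-preserving map A^p -> A / A_+ is a column of elements of
   degree 0, read modulo A_+. *)
Definition linear_resolution (b : nat -> nat)
    (eps : 'cV[A]_(b 0%N)) (d : forall i, 'M[A]_(b i.+1, b i)) : Prop :=
  [/\ forall j, gr 0%N (eps j 0),
      forall i j l, gr 1%N (d i j l),
      exists v : 'rV[A]_(b 0%N), irrelevant (1 - (v *m eps) 0 0),
      forall v : 'rV[A]_(b 0%N),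
        irrelevant ((v *m eps) 0 0) <-> exists w, v = w *m d 0%N
    & forall i (v : 'rV[A]_(b i.+1)),
        v *m d i = 0 <-> exists w, v = w *m d i.+1].

Definition koszul : Prop := exists b eps d, @linear_resolution b eps d.

End Koszul.

Section ComplementaryEdgeIdeal.
Variables (K : fieldType) (n m : nat) (G : sgraph n m).

Local Notation S := {mpoly K[n]}.
Local Notation T := {mpoly K[n + m]}.

(* (x_1 ... x_n) / (x_p x_q), where e_i = {p, q}. *)
Definition cgen (i : 'I_m) : S := \prod_(p in ~: G i) 'X_p.

Lemma cgenE i : cgen i * \prod_(p in G i) 'X_p = \prod_p 'X_p.
Proof.
rewrite mulrC [RHS](bigID (fun p => p \in G i)) /=; congr (_ * _).
by apply: eq_bigl => p; rewrite inE.
Qed.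

Definition cedge_ideal : S -> Prop := ideal_gen (fun p => exists i, p = cgen i).

(* The first n variables of T are x_1, ..., x_n, the last m are y_1, ..., y_m. *)
Definition phi_var (l : 'I_(n + m)) : {poly S} :=
  match split l with
  | inl p => ('X_p)%:P
  | inr i => (cgen i)%:P * 'X
  end.

(* phi, composed with the inclusion of the Rees algebra in S[t]. *)
Definition phi : T -> {poly S} := mmap (polyC \o @mpolyC n K) phi_var.

HB.instance Definition _ := GRing.RMorphism.copy phi
  (mmap (polyC \o @mpolyC n K) phi_var).

Lemma phi_mpolyC (c : K) : phi c%:MP = (c%:MP)%:P.
Proof. exact: mmapC. Qed.

Lemma phi_x p : phi 'X_(lshift m p) = ('X_p)%:P.
Proof. by rewrite /phi mmapX mmap1U /phi_var (unsplitK (inl p)). Qed.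

Lemma phi_y i : phi 'X_(rshift n i) = (cgen i)%:P * 'X.
Proof. by rewrite /phi mmapX mmap1U /phi_var (unsplitK (inr i)). Qed.

Lemma phi_var_rees l : phi_var l \in rees_pred cedge_ideal.
Proof.
apply/rees_predP => k; rewrite /phi_var; case: (split l) => [p|i].
  by rewrite coefC; case: k => [|k]; [exact: ideal_pow0 | exact: ideal_gen0].
rewrite coefCM coefX; case: eqP => [->|_]; last by rewrite mulr0; exact: ideal_gen0.
rewrite mulr1; apply: ideal_gen_sub; exists [tuple cgen i]; last by rewrite big_seq1.
by move=> x; rewrite inE => /eqP->; apply: ideal_gen_sub; exists i.
Qed.

Lemma phi_rees f : phi f \in rees_pred cedge_ideal.
Proof.
rewrite /phi /mmap; apply: rpred_sum => a _; apply: rpredM.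
  apply/rees_predP => -[|k]; first exact: ideal_pow0.
  by rewrite coefC; apply: ideal_gen0.
by rewrite /mmap1; apply: rpred_prod => l _; rewrite rpredX ?phi_var_rees.
Qed.

Definition cRees := rees cedge_ideal.
HB.instance Definition _ := GRing.ComNzRing.on cRees.

Definition phiR (f : T) : cRees := Rees (phi_rees f).

Lemma phiR_surj (a : cRees) : exists f, a = phiR f.
Proof.
suff [f Ef]: exists f, rees_val a = phi f by exists f; apply: val_inj.
have imD (I : Type) (s : seq I) (Q : pred I) (F : I -> {poly S}) :
    (forall x, Q x -> exists f, F x = phi f) ->
    exists f, \sum_(x <- s | Q x) F x = phi f.
  move=> imF; elim/big_ind: _ => //; first by exists 0; rewrite rmorph0.
  by move=> _ _ [f ->] [g ->]; exists (f + g); rewrite rmorphD.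
have imM u v : (exists f, u = phi f) -> (exists f, v = phi f) ->
    exists f, u * v = phi f.
  by move=> [f ->] [g ->]; exists (f * g); rewrite rmorphM.
have imS (c : S) : exists f, c%:P = phi f.
  rewrite (mpolyE c) raddf_sum; apply: (imD) => // u _ /=.
  rewrite -mul_mpolyC rmorphM; apply: (imM).
    by exists (c@_u)%:MP; rewrite phi_mpolyC.
  rewrite mpolyXE_id rmorph_prod /=.
  exists (\prod_(p < n) 'X_(lshift m p) ^+ u p).
  by rewrite rmorph_prod; apply: eq_bigr => p _; rewrite !rmorphXn /= phi_x.
case: a => f /= /rees_predP If; rewrite -[f]coefK poly_def.
apply: (imD) => // k _; rewrite -mul_polyC; move: (k : nat) (If k) => {}k [s Is ->].
rewrite rmorph_sum mulr_suml big_seq; apply: (imD) => // -[c z] /Is /= [t It ->].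
rewrite rmorphM -mulrA; apply: (imM); first exact: imS.
elim: k t It {Is} => [|k IHk] t It.
  case: t It => [[|y t] szt] It; last by [].
  by rewrite /= big_nil rmorph1 mul1r; exists 1; rewrite expr0 rmorph1.
case/tupleP: t It => x t It; rewrite big_cons rmorphM exprS mulrACA; apply: (imM); last first.
  by apply: IHk => y ty; apply: It; rewrite inE ty orbT.
have [r Ir ->] : cedge_ideal x by apply: It; rewrite mem_head.
rewrite rmorph_sum mulr_suml big_seq; apply: (imD) => // -[d y] /Ir /= [i ->].
rewrite rmorphM -mulrA; apply: (imM); first exact: imS.
by exists 'X_(rshift n i); rewrite phi_y.
Qed.

Definition defining_ideal (f : T) : Prop := phiR f = 0.

(* The grading of the Rees algebra with x_1, ..., x_n, u_1 t, ..., u_m t in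
   degree 1, transported along phi from the standard grading of T. *)
Definition cRees_gr (d : nat) (a : cRees) : Prop :=
  exists2 f : T, f \is d.-homog & a = phiR f.

End ComplementaryEdgeIdeal.

(* Main.v *)
Require Import Defs.
From HB Require Import structures.
From mathcomp Require Import all_boot all_order all_algebra.
From mathcomp Require Import boolp.
From mathcomp Require Import mpoly.
From mathcomp Require Import zify.

(** Attach the vertices of the tree [G] one by one to a root.  Every edge [i] then
    has an upper endpoint [top i], which it attaches, and a lower endpoint [bot i].
    If an edge joins [a] and [b], then [x_a] times its generator [u t] of the Rees
    algebra is [(x_1 ... x_n / x_b) t], which depends on [b] only.  Hence, for every
    edge [i] except the lowest, [x_(top i) y_i - x_g y_j] lies in [J], where the edge
    [j] joins [bot i] and [g] and consists of vertices attached before [top i].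

    Give every variable the rank of the vertex it is attached with.  In a monomial
    order that compares total rank first, the initial monomial of this binomial is
    [x_(top i) y_i].  The monomials divisible by none of these products are mapped
    by [phi] to distinct monomials ([tree_standard_inj]): their exponents can be
    recovered from the top of the tree downwards.  Since rewriting yields smaller
    standard monomials, an element of [J] with a standard initial monomial would give
    a nontrivial linear relation between these images.  There is none, so the
    binomials form a quadratic Groebner basis ([toric_quadratic_groebner]).

    For Koszulness, a linear resolution is built from a Koszul filtration, that is a
    family of ideals generated by linear forms, taken one after the other, whose
    successive colon ideals stay in the family ([koszul_filtration]): the syzygies of
    generators with such colon ideals are generated by linear vectors of the same
    kind ([filtered_syzygies]).  The initial monomials involve disjoint pairs
    [x_(top i)], [y_i] of variables, and the algebra grows along the tree by two
    variables whose product is a quadric in the previous ones.  So the filtration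
    consists of the ideals of all variables up to some edge, possibly with one
    variable of the next pair: modulo the previous variables, the annihilator of either
    variable of a pair is generated by the other one ([colon_edge]), and killing
    [x_(top i)] makes [y_i] a nonzerodivisor ([colon_top_y]). *)

Set Implicit Arguments.
Unset Strict Implicit.
Unset Printing Implicit Defensive.
Import GRing.Theory Order.Theory.
Local Open Scope ring_scope.

(** * Linear resolutions from Koszul filtrations *)

Section Span.
Variable A : comNzRingType.

Definition lspan (M : lmodType A) (gs : seq M) (v : M) : Prop :=
  exists c : nat -> A, v = \sum_(i < size gs) c i *: gs`_i.

Lemma lspan_nil (M : lmodType A) (v : M) : lspan [::] v <-> v = 0.
Proof.
split=> [[c ->]|->]; first by rewrite big_ord0.
by exists (fun=> 0); rewrite big_ord0.
Qed.

Lemma lspan_const (s : seq A) (a : A) :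
  lspan [seq const_mx l : 'rV[A]_1 | l <- s] (const_mx a) <->
  @lspan A^o s a.
Proof.
split=> -[c Ec]; exists c.
  move/rowP/(_ 0): Ec; rewrite mxE summxE size_map => ->.
  by apply: eq_bigr => i _; rewrite (nth_map 0) // !mxE.
apply/rowP=> j; rewrite mxE summxE size_map Ec.
by apply: eq_bigr => i _; rewrite (nth_map 0) // !mxE.
Qed.

Lemma lspan_rcons (M : lmodType A) (s : seq M) (g v : M) :
  lspan (rcons s g) v <-> exists a, lspan s (v - a *: g).
Proof.
split=> [[c ->]|[a [c Ec]]].
  exists (c (size s)), c; rewrite size_rcons big_ord_recr /=.
  rewrite nth_rcons ltnn eqxx addrK; apply: eq_bigr => i _.
  by rewrite nth_rcons ltn_ord.
exists (fun i => if i == size s then a else c i).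
rewrite size_rcons big_ord_recr /= nth_rcons ltnn eqxx.
rewrite -[v in LHS](subrK (a *: g)) Ec; congr (_ + _); apply: eq_bigr => i _.
by rewrite nth_rcons ltn_ord ltn_eqF.
Qed.

Lemma lspan0 (M : lmodType A) (s : seq M) : lspan s 0.
Proof. by exists (fun=> 0); rewrite big1 // => i _; rewrite scale0r. Qed.

Lemma lspanD (M : lmodType A) (s : seq M) (u v : M) :
  lspan s u -> lspan s v -> lspan s (u + v).
Proof.
move=> [c ->] [d ->]; exists (fun i => c i + d i); rewrite -big_split /=.
by apply: eq_bigr => i _; rewrite scalerDl.
Qed.

Lemma lspanZ (M : lmodType A) (s : seq M) a (v : M) :
  lspan s v -> lspan s (a *: v).
Proof.
move=> [c ->]; exists (fun i => a * c i); rewrite scaler_sumr.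
by apply: eq_bigr => i _; rewrite scalerA.
Qed.

Lemma lspan_mem (M : lmodType A) (s : seq M) (g : M) : g \in s -> lspan s g.
Proof.
move=> sg; exists (fun i => (i == index g s)%:R).
have lt_i : (index g s < size s)%N by rewrite index_mem.
rewrite (bigD1 (Ordinal lt_i)) //= eqxx scale1r nth_index // big1 ?addr0 // => i.
by rewrite -val_eqE /= => /negPf->; rewrite scale0r.
Qed.

End Span.

Notation lideal A s := (@lspan A A^o s).

Section KoszulFiltration.
Variables (A : comNzRingType) (F : seq A -> Prop).

(** A list of generators that is built one generator at a time, every successive
    colon ideal belonging to the family [F].  This is the form in which a Koszul
    filtration propagates to syzygies. *)
Inductive filtered (M : lmodType A) : seq M -> Prop :=
| filtered_nil : filtered [::]
| filtered_rcons s g t : filtered s -> F t ->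
    (forall a, lspan s (a *: g) <-> lideal A t a) -> filtered (rcons s g).

(** [comp d] is the projection of [A] to its component of degree [d]. *)
Variable gr : nat -> A -> Prop.
Variable comp : nat -> {additive A -> A}.
Hypothesis gr_comp : forall d a, gr d (comp d a).
Hypothesis comp_gr1 : forall a, gr 1%N a -> comp 1 a = a.
Hypothesis compMgr1 : forall a g, gr 1%N g -> comp 2 (a * g) = comp 1 a * g.

Definition linear_vec q (g : 'rV[A]_q) : Prop := forall j, gr 1%N (g 0 j).

Hypothesis gr1N : forall a, gr 1%N a -> gr 1%N (- a).

Lemma gr1_0 : gr 1%N 0.
Proof. by rewrite -(raddf0 (comp 1)). Qed.

(** [F] is a Koszul filtration: it consists of lists of linear generators, it is
    stable under dropping the last generator, and the colon of what precedes the
    last generator by that generator is again in [F]. *)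
Hypothesis F_rcons : forall t l, F (rcons t l) ->
  [/\ F t, gr 1%N l &
    exists2 t', F t' & forall a, lideal A t (a * l) <-> lideal A t' a].

(** Taking components of degree 1 of the coefficients replaces an arbitrary
    relation between linear vectors by a linear one. *)
Lemma linear_coefs q (s : seq 'rV[A]_q) (g : 'rV[A]_q) l :
  (forall h, h \in s -> linear_vec h) -> linear_vec g -> gr 1%N l ->
  lspan s (l *: g) ->
  exists2 c : nat -> A, (forall i, gr 1%N (c i))
    & l *: g = \sum_(i < size s) c i *: s`_i.
Proof.
move=> lin_s lin_g lin_l [c Ec]; exists (fun i => comp 1 (c i)) => //.
apply/rowP=> j; move/rowP/(_ j): Ec; rewrite !mxE !summxE => /(congr1 (comp 2)).
rewrite compMgr1 // comp_gr1 // raddf_sum => ->.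
apply: eq_bigr => i _; rewrite !mxE compMgr1 //.
exact/lin_s/mem_nth.
Qed.

(** The syzygy module of a filtered list is generated by a filtered list of linear
    vectors, so that the construction can be repeated.  By induction on the list:
    projecting the syzygies of [rcons s g] to the coordinate of [g] has as kernel
    the syzygies of [s], and as image the colon ideal of [s] by [g], which is
    generated by some list of [F].  Lifting the generators of this image one by
    one produces new syzygies, whose successive colon ideals are those of the list
    of [F], since membership is decided in the coordinate of [g]. *)
Lemma filtered_syzygies q (gs : seq 'rV[A]_q) p :
  filtered gs -> (forall g, g \in gs -> linear_vec g) -> (size gs <= p)%N ->
  exists hs : seq 'rV[A]_p,
    [/\ filtered hs, forall h, h \in hs -> linear_vec h
      & forall v : 'rV[A]_p, lspan hs v <->
          (forall i : 'I_p, (size gs <= i)%N -> v 0 i = 0) /\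
          \sum_(i < p) v 0 i *: gs`_i = 0].
Proof.
elim=> [|{}s g t fs IHs Ft colon] lin_gs le_p.
  exists [::]; split=> // [|v]; first exact: filtered_nil.
  split=> [/lspan_nil->|[v0 _]]; last first.
    by apply/lspan_nil/rowP=> i; rewrite mxE v0.
  by split=> [i _|]; rewrite ?mxE // big1 // => i _; rewrite mxE scale0r.
rewrite size_rcons in le_p *.
have lin_s h : h \in s -> linear_vec h.
  by move=> sh; apply: lin_gs; rewrite mem_rcons inE sh orbT.
have lin_g : linear_vec g by apply: lin_gs; rewrite mem_rcons mem_head.
have [hs [f_hs lin_hs spanhs]] := IHs lin_s (ltnW le_p).
pose k := Ordinal le_p.
pose syz (v : 'rV[A]_p) := (forall i : 'I_p, (size s < i)%N -> v 0 i = 0) /\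
          \sum_(i < p) v 0 i *: (rcons s g)`_i = 0.
have sum_split (v : 'rV[A]_p) :
  \sum_(i < p) v 0 i *: (rcons s g)`_i =
    v 0 k *: g + \sum_(i < p) v 0 i *: s`_i.
  rewrite (bigD1 k) //= nth_rcons ltnn eqxx; congr (_ + _).
  rewrite [RHS](bigD1 k) //= nth_default // scaler0 add0r.
  apply: eq_bigr => i; rewrite -val_eqE /= => /negPf nik; rewrite nth_rcons.
  by case: ltngtP nik => // lt_i _; rewrite nth_default // ltnW.
have syzB u v a : syz u -> syz (v - a *: u) <-> syz v.
  move=> [u0 su]; have E w b : \sum_(i < p) (w - b *: u) 0 i *: (rcons s g)`_i
      = \sum_(i < p) w 0 i *: (rcons s g)`_i.
    under eq_bigr => i _ do rewrite !mxE scalerBl -scalerA.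
    by rewrite sumrB -scaler_sumr su scaler0 subr0.
  split=> -[v0 sv]; split.
  - by move=> i lt_i; have := v0 i lt_i; rewrite !mxE u0 // mulr0 subr0.
  - by rewrite -(E v a).
  - by move=> i lt_i; rewrite !mxE u0 // v0 // mulr0 subr0.
  - by rewrite E.
suff /(_ t Ft) [l tl|H [fH linH spanH]] : forall t', F t' ->
    (forall l, l \in t' -> lideal A t l) -> exists H : seq 'rV[A]_p,
    [/\ filtered H, forall h, h \in H -> linear_vec h
      & forall v : 'rV[A]_p, lspan H v <-> syz v /\ lideal A t' (v 0 k)].
- exact: lspan_mem.
- (* The last coordinate of a syzygy lies in the colon ideal automatically. *)
  exists H; split=> // v; split=> [/spanH[]//|[v0 sv]].
  apply/spanH; split=> //; apply/colon; move: sv; rewrite sum_split.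
  move/eqP; rewrite addr_eq0 => /eqP->.
  exists (fun i => if insub i is Some j then - v 0 j else 0).
  rewrite [in LHS](bigID (fun i : 'I_p => (i < size s)%N)) /= addrC big1 ?add0r.
    rewrite (big_ord_widen p (fun i => (if insub i is Some j then - v 0 j else 0)
      *: s`_i)) 1?ltnW // -sumrN; apply: eq_bigr => i _.
    by rewrite valK scaleNr.
  by move=> i; rewrite -leqNgt => le_i; rewrite nth_default ?scaler0.
elim/last_ind=> [|t' l IHt'] Ft' sub_t'.
  exists hs; split=> // v; rewrite spanhs /syz sum_split.
  split=> [[v0 sv]|[[v0 sv] /lspan_nil vk0]].
    rewrite v0 //= scale0r add0r.
    by split; [split=> // i /ltnW /v0 | apply/lspan_nil].
  split=> [i|]; last by move: sv; rewrite vk0 scale0r add0r.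
  rewrite leq_eqVlt => /orP[/eqP Ei|/v0 //].
  by rewrite -vk0; congr (v 0 _); apply: val_inj.
have [Ft1 lin_l [t2 Ft2 colon_l]] := F_rcons Ft'.
have [|H [fH linH spanH]] := IHt' Ft1.
  by move=> a t'a; apply: sub_t'; rewrite mem_rcons inE t'a orbT.
have /colon /(linear_coefs lin_s lin_g lin_l)[c lin_c Ec] : lideal A t l.
  by apply: sub_t'; rewrite mem_rcons mem_head.
(* The lift of [l]: the syzygy expressing [l *: g] through [s]. *)
pose h : 'rV[A]_p := \row_i (if (i < size s)%N then - c i else
                              if i == k then l else 0).
have hk : h 0 k = l by rewrite mxE ltnn eqxx.
have syz_h : syz h.
  split=> [i lt_i|]; first by rewrite mxE ltnNge ltnW //= -val_eqE gtn_eqF.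
  rewrite sum_split hk Ec (big_ord_widen p (fun i => c i *: s`_i)) 1?ltnW //.
  rewrite big_mkcond -big_split big1 //= => i _; rewrite mxE.
  case: ltnP => [_|le_i]; first by rewrite scaleNr subrr.
  by rewrite add0r nth_default // scaler0.
have lin_h : linear_vec h.
  move=> i; rewrite mxE; case: ifP => _; first exact: gr1N.
  by case: ifP => // _; exact: gr1_0.
clearbody h.
exists (rcons H h); split.
- apply: (filtered_rcons fH Ft2) => a; rewrite -colon_l spanH mxE hk.
  split=> [[]//|tal]; split=> //.
  split=> [i lt_i|]; first by rewrite mxE syz_h.1 // mulr0.
  rewrite (eq_bigr (fun i => a *: (h 0 i *: (rcons s g)`_i))) => [|i _].
    by rewrite -scaler_sumr syz_h.2 scaler0.
  by rewrite mxE scalerA.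
- by move=> u; rewrite mem_rcons inE => /predU1P[->|/linH].
move=> v; split=> [/lspan_rcons[a /spanH[]]|[syz_v /lspan_rcons[a ta]]].
  rewrite syzB // !mxE hk => syz_v tv; split=> //.
  by apply/lspan_rcons; exists a.
apply/lspan_rcons; exists a; apply/spanH; split; first exact/syzB.
by rewrite !mxE hk.
Qed.

Lemma filtered_ideal t :
  F t -> filtered [seq const_mx l : 'rV[A]_1 | l <- t].
Proof.
elim/last_ind: t => [|t l IHt] Ftl; first exact: filtered_nil.
have [Ft _ [t' Ft' colon]] := F_rcons Ftl.
rewrite map_rcons; apply: (filtered_rcons (IHt Ft) Ft') => a; rewrite -colon.
rewrite -lspan_const; set u := _ *: _; set v := const_mx _.
by suff -> : u = v by []; apply/rowP=> i; rewrite !mxE.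
Qed.

Lemma F_linear t l : F t -> l \in t -> gr 1%N l.
Proof.
elim/last_ind: t => // t x IHt /F_rcons[Ft lin_x _].
by rewrite mem_rcons inE => /predU1P[->//|]; apply: IHt.
Qed.

Hypothesis gr0_1 : gr 0%N 1.

(** Iterating [filtered_syzygies] from the generators of the irrelevant ideal gives
    a linear resolution of the residue field. *)
Theorem koszul_filtration z :
  F z -> (forall a, irrelevant gr a <-> lideal A z a) -> koszul gr.
Proof.
move=> Fz irrP.
pose state := {q : nat & seq 'rV[A]_q}.
pose good (s : state) :=
  filtered (tagged s) /\ forall g, g \in tagged s -> linear_vec g.
pose syzygies (s : state) (hs : seq 'rV[A]_(size (tagged s))) :=
  forall v : 'rV[A]_(size (tagged s)),
    lspan hs v <-> \sum_i v 0 i *: (tagged s)`_i = 0.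
have next (s : state) : exists hs : seq 'rV[A]_(size (tagged s)),
    good s -> good (existT _ _ hs) /\ syzygies s hs.
  have [gs|ngs] := pselect (good s); last by exists [::] => /ngs.
  have [hs [fhs lin_hs spanhs]] := filtered_syzygies gs.1 gs.2 (leqnn _).
  exists hs => _; split=> // v; rewrite spanhs; split=> [[]//|sv].
  by split=> // i; rewrite leqNgt ltn_ord.
pose step s : state := existT _ (size (tagged s)) (projT1 (cid (next s))).
pose st i := iter i step (existT _ 1%N [seq const_mx l : 'rV[A]_1 | l <- z]).
have st_good i : good (st i).
  elim: i => [|i /(projT2 (cid (next (st i))))[]//]; split.
    exact: filtered_ideal.
  by move=> _ /mapP[l zl ->] j; rewrite mxE; apply: F_linear zl.
have st_syz i : syzygies (st i) (tagged (st i.+1)).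
  by case: (projT2 (cid (next (st i))) (st_good i)).
pose d i : 'M[A]_(tag (st i.+1), tag (st i)) := \matrix_j (tagged (st i))`_j.
have dE i (v : 'rV[A]_(tag (st i.+1))) :
    v *m d i = \sum_j v 0 j *: (tagged (st i))`_j.
  by rewrite mulmx_sum_row; apply: eq_bigr => j _; rewrite rowK.
have dP i (v : 'rV[A]_(tag (st i))) :
    lspan (tagged (st i)) v <-> exists w, v = w *m d i.
  split=> [[c ->]|[w ->]]; rewrite ?dE.
    exists (\row_(j < size (tagged (st i))) c j); rewrite dE.
    by apply: eq_bigr => j _; rewrite mxE.
  exists (fun j => if insub j is Some j' then w 0 j' else 0).
  by apply: eq_bigr => j _; rewrite valK.
have eps1 : (const_mx 1 : 'M[A]_1) = 1%:M.
  by apply/matrixP=> i j; rewrite !ord1 !mxE.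
exists (fun i => tag (st i)), (const_mx 1), d; split=> [j|i j l||v|i v].
- by rewrite mxE.
- by rewrite mxE; apply: (st_good i).2; apply: mem_nth.
- exists 1%:M; rewrite mul1mx mxE subrr; apply/irrP; exact: lspan0.
- rewrite eps1 mulmx1 irrP -dP /= -lspan_const; set u := const_mx _.
  by suff -> : u = v by []; apply/rowP=> i; rewrite !mxE !ord1.
by rewrite -dP dE; apply: iff_sym; exact: st_syz.
Qed.

End KoszulFiltration.

(** * Toric ideals with quadratic rewriting rules *)

Section WeightOrder.
Variables (N : nat) (rk : 'I_N -> nat).

Definition wt (u : 'X_{1..N}) : nat := (\sum_i u i * rk i)%N.

(** Refining the weight by a fixed monomial order gives a monomial order in which
    any prescribed decrease of weight decides the initial monomial. *)
Definition wle : rel 'X_{1..N} :=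
  fun u v => (wt u < wt v)%N || ((wt u == wt v) && (u <= v)%O).

Lemma wtD u v : wt (u + v)%MM = (wt u + wt v)%N.
Proof.
by rewrite -big_split; apply: eq_bigr => i _; rewrite mnmDE mulnDl.
Qed.

Lemma wtU i : wt U_(i)%MM = rk i.
Proof.
rewrite /wt (bigD1 i) //= mnm1E eqxx mul1n big1 ?addn0 // => j.
by rewrite mnm1E eq_sym => /negPf->.
Qed.

Lemma wle_wt u v : wle u v -> (wt u <= wt v)%N.
Proof. by move=> /orP[/ltnW//|/andP[/eqP->]]. Qed.

Lemma wle_monomial_order : monomial_order wle.
Proof.
split=> [u v|u v|v u w|u|u v w]; rewrite /wle.
- by case: ltngtP => //= _; exact: le_total.
- by case: ltngtP => //= _; exact: le_anti.
- case: ltngtP => //= [luv|Euv]; case: ltngtP => //= [lvw|Evw].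
  + by rewrite (ltn_trans luv).
  + by rewrite -Evw luv.
  + by rewrite Euv lvw.
  + by rewrite Euv Evw ltnn eqxx; exact: le_trans.
- have -> : wt 0%MM = 0%N by rewrite /wt big1 // => i _; rewrite mnm0E.
  by case: ltngtP => //= _; exact: le0m.
- rewrite !wtD ltn_add2r eqn_add2r => /orP[->//|/andP[-> le_uv]].
  by rewrite lem_add ?orbT.
Qed.

End WeightOrder.

Section Toric.
Variables (K : fieldType) (N : nat).
Local Notation T := {mpoly K[N]}.
Local Notation mono2 p := (U_(p.1) + U_(p.2))%MM.

(** [theta u] stands for the image of the monomial of exponent [u] under a monomial
    map, and [cls w f] for the coefficient of the monomial [w] in the image of [f];
    the toric ideal is the kernel. *)
Variables (Theta : eqType) (theta : 'X_{1..N} -> Theta).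
Hypothesis thetaD : forall u v w,
  (theta (u + w)%MM == theta (v + w)%MM) = (theta u == theta v).
Hypothesis theta_deg : forall u v, theta u = theta v -> mdeg u = mdeg v.

Variable cls : Theta -> {scalar T}.
Hypothesis clsX : forall w u, cls w 'X_[u] = (theta u == w)%:R.

Lemma clsE w f : cls w f = \sum_(u <- msupp f) f@_u * (theta u == w)%:R.
Proof.
by rewrite {1}[f]mpolyE linear_sum; apply: eq_bigr => u _; rewrite linearZ /= clsX.
Qed.

Definition toric_ideal (f : T) : Prop := forall w, cls w f = 0.

(** A rule [((a, b), (c, d))] rewrites [X_a X_b] into [X_c X_d]. *)
Variables (rules : seq (('I_N * 'I_N) * ('I_N * 'I_N))) (rk : 'I_N -> nat).
Hypothesis rule_neq : forall r, r \in rules -> r.1.1 != r.1.2.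
Hypothesis rule_theta : forall r, r \in rules ->
  theta (mono2 r.1) = theta (mono2 r.2).
Hypothesis rule_rk : forall r, r \in rules ->
  (rk r.2.1 + rk r.2.2 < rk r.1.1 + rk r.1.2)%N.

Definition standard (u : 'X_{1..N}) : bool :=
  all (fun r => (u r.1.1 == 0%N) || (u r.1.2 == 0%N)) rules.

Hypothesis standard_inj : forall u v,
  standard u -> standard v -> theta u = theta v -> u = v.

Definition meets (W : seq 'I_N) (u : 'X_{1..N}) : bool :=
  has (fun i => u i != 0%N) W.

(** Rewriting preserves the presence of a variable of [W] in a monomial. *)
Definition rule_closed (W : seq 'I_N) : Prop := forall r, r \in rules ->
  (r.1.1 \in W) || (r.1.2 \in W) -> (r.2.1 \in W) || (r.2.2 \in W).

Lemma nonstandardP u : ~~ standard u ->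
  exists2 r, r \in rules & exists w, u = (w + mono2 r.1)%MM.
Proof.
move=> /allPn[r rr]; rewrite negb_or => /andP[ua ub]; exists r => //.
exists (u - mono2 r.1)%MM; rewrite submK //; apply/mnm_lepP=> i.
rewrite -lt0n in ua; rewrite -lt0n in ub; have /negPf nab := rule_neq rr.
rewrite mnmDE !mnm1E; case: (r.1.1 =P i) => [<-|_].
  by rewrite eq_sym nab addn0.
by case: (r.1.2 =P i) => [<-|].
Qed.

(** Each rewriting step lowers the weight, hence terminates; it keeps the image
    under [theta] and the presence of variables of a closed set. *)
Lemma normal_form u : exists v, [/\ standard v, theta v = theta u,
  wle rk v u & forall W, rule_closed W -> meets W u -> meets W v].
Proof.
move: {2}(wt rk u) (leqnn (wt rk u)) => k; elim/ltn_ind: k u => k IHk u le_uk.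
have [std_u|/nonstandardP[r rr [w Eu]]] := boolP (standard u).
  by exists u; split=> //; rewrite /wle eqxx lexx orbT.
pose u' := (w + mono2 r.2)%MM.
have lt_u' : (wt rk u' < wt rk u)%N.
  by rewrite Eu !wtD !wtU ltn_add2l rule_rk.
have [v [std_v Ev le_v meets_v]] := IHk _ (leq_trans lt_u' le_uk) u' (leqnn _).
exists v; split=> // [||W clW /hasP[i Wi ui]].
- apply/eqP; rewrite Ev Eu /u' ![(w + _)%MM]addmC thetaD.
  by rewrite rule_theta.
- by rewrite /wle (leq_ltn_trans (wle_wt le_v)).
apply: meets_v => //.
have [/(clW _ rr)|] := boolP ((r.1.1 \in W) || (r.1.2 \in W)).
  by case/orP=> Wj; apply/hasP; [exists r.2.1 | exists r.2.2] => //;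
    rewrite !mnmDE !mnm1E eqxx !addnS ?addSn // addnS.
rewrite negb_or => /andP[Wa Wb]; apply/hasP; exists i => //; move: ui.
rewrite Eu !mnmDE !mnm1E.
case: (r.1.1 =P i) => [Ei|_]; first by rewrite Ei Wi in Wa.
case: (r.1.2 =P i) => [Ei|_]; first by rewrite Ei Wi in Wb.
by rewrite addn0 -lt0n => wi; rewrite -lt0n (leq_trans wi) ?leq_addr.
Qed.

Lemma toric_binomial u v : theta u = theta v -> toric_ideal ('X_[u] - 'X_[v]).
Proof. by move=> Euv w; rewrite raddfB /= !clsX Euv subrr. Qed.

Definition rule_binomial (r : ('I_N * 'I_N) * ('I_N * 'I_N)) : T :=
  'X_[mono2 r.1] - 'X_[mono2 r.2].

Lemma rule_supp r u : r \in rules -> u \in msupp (rule_binomial r) ->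
  u = mono2 r.1 \/ u = mono2 r.2.
Proof.
move=> rr /msuppB_le; rewrite mem_cat !msuppX !inE.
by case/orP=> /eqP; [left | right].
Qed.

Lemma rule_lead_supp r : r \in rules -> mono2 r.1 \in msupp (rule_binomial r).
Proof.
move=> rr; rewrite mcoeff_msupp mcoeffB !mcoeffX eqxx.
case: (mono2 r.2 =P mono2 r.1) => [E|_]; last by rewrite subr0 oner_eq0.
by have := rule_rk rr; rewrite -!wtU -!wtD -E ltnn.
Qed.

Lemma rule_neq0 r : r \in rules -> rule_binomial r != 0.
Proof. by move=> /rule_lead_supp; apply: contraTneq => ->; rewrite msupp0. Qed.

Lemma rule_inm r : r \in rules -> inm (wle rk) (rule_binomial r) = mono2 r.1.
Proof.
move=> rr; have ord := wle_monomial_order rk.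
have [//|E] := rule_supp rr (inm_supp (rule_neq0 rr) ord).
have := inm_max ord (rule_lead_supp rr); rewrite E => /wle_wt.
by rewrite leqNgt !wtD !wtU rule_rk.
Qed.

(** If the initial monomial [u] of an element of the toric ideal were standard,
    another monomial [v] of its support would have the same image, because the
    coefficient of this image vanishes.  The normal form of [v] is then [u], which
    makes [u] at most [v], against the maximality of [u].  So every initial
    monomial is divisible by the left side of a rule. *)
Theorem toric_quadratic_groebner :
  has_quadratic_groebner_basis (wle rk) toric_ideal.
Proof.
have ord := wle_monomial_order rk.
exists [seq rule_binomial r | r <- rules]; last first.
  move=> _ /mapP[r rr ->].
  have homr : rule_binomial r \is 2.-homog.
    by apply: rpredB; rewrite dhomogX /= mdegD !mdeg1.
  have := dhomog_uniq (rule_neq0 rr) (dhomog_msize homr) homr.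
  by case: (msize _) => //= k ->.
split=> [_ /mapP[r rr ->]|p].
  by split; [apply: toric_binomial; exact: rule_theta | exact: rule_neq0].
split=> [[s Xs ->]|[s Xs ->]]; last first.
  exists s => // z /Xs[f [/mapP[r rr ->] nz ->]]; exists (rule_binomial r).
  by split=> //; apply: toric_binomial; exact: rule_theta.
rewrite big_seq; apply: ideal_gen_sum => z /Xs[f [If nz ->]].
apply: ideal_genM; set u := inm _ f.
have [std_u|/nonstandardP[r rr [w Eu]]] := boolP (standard u); last first.
  rewrite Eu mpolyXD; apply: ideal_genM; apply: ideal_gen_sub.
  exists (rule_binomial r); split; rewrite ?rule_neq0 ?rule_inm //.
  exact: map_f.
have supp_u : u \in msupp f by exact: inm_supp.
suff: f@_u = 0 by move/eqP; rewrite mcoeff_eq0 supp_u.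
rewrite -(If (theta u)) clsE (bigD1_seq u) ?msupp_uniq //= eqxx mulr1.
rewrite big1_seq ?addr0 // => v /andP[nvu supp_v].
case: (theta v =P _) => [Ev|_]; last by rewrite mulr0.
case/eqP: nvu.
have [v' [std_v' Ev' le_v' _]] := normal_form v.
have Evu : v' = u by apply: standard_inj => //; rewrite Ev'.
have [_ anti _ _ _] := ord; apply: anti.
by rewrite inm_max //= -/u -Evu.
Qed.

(** As [theta] determines the degree, the kernel of the monomial map is graded. *)
Lemma toric_homogeneous d f : toric_ideal f -> toric_ideal (pihomog mdeg d f).
Proof.
move=> If w; rewrite pihomogE linear_sum /=.
under eq_bigr => u _ do rewrite linearZ /= clsX.
have [/hasP[u0 _ /andP[/eqP Eu0 /eqP deg_u0]]|/hasPn none] :=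
    boolP (has (fun u => (theta u == w) && (mdeg u == d)) (msupp f)).
  rewrite -[RHS](If w) clsE big_mkcond; apply: eq_bigr => u _ /=.
  case: (theta u =P w) => [Eu|_]; last by rewrite mulr0 if_same.
  by rewrite (theta_deg (etrans Eu (esym Eu0))) deg_u0 eqxx.
apply: big1_seq => u /andP[deg_u /none]; rewrite deg_u andbT => /negPf->.
by rewrite mulr0.
Qed.

Section Quotient.
Variables (A : comNzRingType) (rho : {rmorphism T -> A}).
Hypothesis rho_surj : forall a, exists f, a = rho f.
Hypothesis rho_ker : forall f, rho f = 0 <-> toric_ideal f.

Definition quotient_gr (d : nat) (a : A) : Prop :=
  exists2 f : T, f \is d.-homog & a = rho f.

Definition representative (a : A) : T := projT1 (cid (rho_surj a)).

Lemma representativeK a : rho (representative a) = a.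
Proof. by rewrite /representative; case: cid. Qed.

(** The components of the quotient are those of an arbitrary representative; by
    [toric_homogeneous] the choice does not matter. *)
Definition component (d : nat) (a : A) : A := rho (pihomog mdeg d (representative a)).

Lemma component_rho d f : component d (rho f) = rho (pihomog mdeg d f).
Proof.
apply/eqP; rewrite -subr_eq0 -rmorphB -pihomogB; apply/eqP/rho_ker.
by apply: toric_homogeneous; apply/rho_ker; rewrite rmorphB representativeK subrr.
Qed.

Lemma component_additive d : additive (component d).
Proof.
move=> a b; rewrite -(representativeK a) -(representativeK b) -rmorphB.
rewrite !component_rho.
by rewrite pihomogB rmorphB.
Qed.

HB.instance Definition _ d :=
  GRing.isZmodMorphism.Build A A (component d) (component_additive d).

Lemma quotient_gr_component d a : quotient_gr d (component d a).
Proof. by exists (pihomog mdeg d (representative a)) => //; exact: pihomogP. Qed.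

Lemma component_gr d a : quotient_gr d a -> component d a = a.
Proof. by move=> [f hf ->]; rewrite component_rho pihomog_dE. Qed.

Lemma pihomogM_homog d e (f g : T) : g \is e.-homog ->
  pihomog mdeg (d + e) (f * g) = pihomog mdeg d f * g.
Proof.
move=> hg; have le_k : (msize f <= (maxn (msize f) d).+1)%N.
  by rewrite leqW ?leq_maxl.
rewrite {1}(pihomog_partitionE le_k) mulr_suml linear_sum /=.
have lt_d : (d < (maxn (msize f) d).+1)%N by rewrite ltnS leq_maxr.
have homM i : pihomog mdeg i f * g \is (i + e).-homog.
  by apply: dhomogM => //; exact: pihomogP.
rewrite (bigD1 (Ordinal lt_d)) //= pihomog_dE // big1 ?addr0 // => i nid.
by apply: (pihomog_ne0 _ (homM i)); rewrite eqn_add2r.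
Qed.

Lemma componentM1 a g :
  quotient_gr 1 g -> component 2 (a * g) = component 1 a * g.
Proof.
move=> [h hom_h ->]; rewrite -(representativeK a) -rmorphM !component_rho.
by rewrite (@pihomogM_homog 1 1) // rmorphM.
Qed.

Local Notation xs W := [seq rho 'X_i | i <- W].

(** Monomials of the quotient lying in the ideal generated by the variables [W]. *)
Definition in_ideal (W : seq 'I_N) (u : 'X_{1..N}) : Prop :=
  exists2 v, theta v = theta u & meets W v.

Lemma rho_eq u v : theta u = theta v -> rho 'X_[u] = rho 'X_[v].
Proof.
move=> Euv; apply/eqP; rewrite -subr_eq0 -rmorphB; apply/eqP/rho_ker.
exact: toric_binomial.
Qed.

Lemma lideal_rho W f : (forall u, u \in msupp f -> in_ideal W u) ->
  lideal A (xs W) (rho f).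
Proof.
move=> Wf; rewrite [f]mpolyE rmorph_sum big_seq.
elim/big_ind: _ => [||u /Wf[v Evu /hasP[i Wi vi]]];
  [exact: (@lspan0 A A^o) | exact: (@lspanD A A^o) | ].
rewrite -mul_mpolyC rmorphM -(rho_eq Evu); apply: (@lspanZ A A^o).
rewrite -[v](@submK _ U_(i)%MM v) ?lep1mP // mpolyXD rmorphM.
by apply: (@lspanZ A A^o); apply: lspan_mem; exact: map_f.
Qed.

Lemma lideal_lift W a : lideal A (xs W) a ->
  exists2 g, a = rho g & forall v, v \in msupp g -> meets W v.
Proof.
elim/last_ind: W a => [|W i IHW] a.
  by move/lspan_nil->; exists 0; rewrite ?rmorph0 // => v; rewrite msupp0.
rewrite map_rcons => /lspan_rcons[b /IHW[g Eg Wg]].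
exists (g + representative b * 'X_i) => [|v /msuppD_le].
  by rewrite rmorphD rmorphM representativeK -Eg subrK.
rewrite mem_cat => /orP[/Wg|/msuppM_le/allpairsP[[w x] /= [_]]].
  by rewrite /meets has_rcons orbC => ->.
rewrite msuppX inE => /eqP-> ->; rewrite /meets has_rcons.
by rewrite mnmDE mnm1E eqxx addn1.
Qed.

(** Ideals generated by variables are monomial in the quotient: membership can be
    read off the support of a representative without collisions under [theta]. *)
Lemma lideal_rhoP W f :
  {in msupp f &, injective theta} ->
  (lideal A (xs W) (rho f) <-> forall u, u \in msupp f -> in_ideal W u).
Proof.
move=> inj_f; split; last exact: lideal_rho.
move=> /lideal_lift[g Eg Wg] u fu; have /rho_ker/(_ (theta u)) : rho (f - g) = 0.
  by rewrite rmorphB Eg subrr.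
have -> : cls (theta u) (f - g) = f@_u - cls (theta u) g.
  rewrite raddfB /= (clsE _ f) (bigD1_seq u) ?msupp_uniq //= eqxx mulr1.
  rewrite big1_seq ?addr0 //.
  move=> v /andP[nvu fv]; case: (theta v =P _) => [|_]; last by rewrite mulr0.
  by move/inj_f => /(_ fv fu) Ev; rewrite Ev eqxx in nvu.
have [/hasP[v gv /eqP Ev] _|/hasPn none] :=
    boolP (has (fun v => theta v == theta u) (msupp g)).
  by exists v => //; exact: Wg.
rewrite clsE big1_seq ?subr0 => [fu0|v /andP[_ /none/negPf->]]; last by rewrite mulr0.
by move: fu; rewrite mcoeff_msupp fu0 eqxx.
Qed.

Lemma standard_lift a :
  exists2 f, a = rho f & forall u, u \in msupp f -> standard u.
Proof.
rewrite -(representativeK a) [representative a]mpolyE rmorph_sum.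
elim/big_ind: _ => [|_ _ [f -> sf] [g -> sg]|u _].
- by exists 0; rewrite ?rmorph0 // => u; rewrite msupp0.
- exists (f + g); rewrite ?rmorphD // => u /msuppD_le.
  by rewrite mem_cat => /orP[/sf|/sg].
have [v [std_v Ev _ _]] := normal_form u.
exists ((representative a)@_u *: 'X_[v]) => [|w /msuppZ_le].
  by rewrite -!mul_mpolyC !rmorphM (rho_eq Ev).
by rewrite msuppX inE => /eqP->.
Qed.

(** A combinatorial criterion for [W'] to generate the colon of the ideal generated
    by [W] by the variable [z]: the new variables of [W'] multiply [z] into [W], and
    [W'] includes the partners of [z] in the left sides of rules. *)
Record colon_step (W : seq 'I_N) z (W' : seq 'I_N) : Prop := ColonStep {
  colon_closed : rule_closed W;
  colon_notin : z \notin W;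
  colon_sub : {subset W <= W'};
  colon_partner : forall r, r \in rules ->
    (r.1.1 = z -> r.1.2 \in W') /\ (r.1.2 = z -> r.1.1 \in W');
  colon_mem : forall i, i \in W' -> i \in W \/ in_ideal W (U_(i) + U_(z))%MM
}.

(** For the direct implication, let [u'] be the normal form of [u].  If it involves
    no variable of [W'], it involves no partner of [z], so [u' + U_(z)] is still
    standard.  It is then the normal form of a monomial involving [W], hence
    involves [W] itself, and so does [u'] since [z] is not in [W]. *)
Lemma colon_monomial W z W' u : colon_step W z W' ->
  in_ideal W (u + U_(z))%MM <-> in_ideal W' u.
Proof.
move=> [clW nWz subW partner memW']; split=> [[v Ev Wv]|[v Ev /hasP[i W'i vi]]].
  have [v' [std_v' Ev' _ /(_ W clW Wv) Wv']] := normal_form v.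
  have [u' [std_u' Eu' _ _]] := normal_form u.
  exists u' => //; have [//|/hasPn nW'u'] := boolP (meets W' u').
  have std_u'z : standard (u' + U_(z))%MM.
    apply/allP=> r rr; move/allP/(_ r rr): std_u'; rewrite !mnmDE !mnm1E.
    have [p1 p2] := partner r rr; have := rule_neq rr.
    case: (z =P r.1.1) => [Ez|_]; case: (z =P r.1.2) => [Ez'|_]; rewrite ?addn0 //.
    - by rewrite -Ez Ez' eqxx.
    - by move/esym/p1/nW'u': Ez; rewrite negbK => ->; rewrite !orbT.
    - by move/esym/p2/nW'u': Ez'; rewrite negbK => ->.
  have E : v' = (u' + U_(z))%MM.
    apply: standard_inj => //; rewrite Ev' Ev; apply/eqP.
    by rewrite eq_sym thetaD Eu'.
  case/hasP: Wv' => i Wi; rewrite E mnmDE mnm1E.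
  have [Ez|_] := z =P i; first by rewrite Ez Wi in nWz.
  by rewrite addn0; have := nW'u' i (subW i Wi); rewrite negbK => ->.
have [Wi|[w Ew /hasP[j Wj wj]]] := memW' i W'i.
  exists (v + U_(z))%MM; first by apply/eqP; rewrite thetaD Ev.
  apply/hasP; exists i => //; rewrite mnmDE; move: vi.
  by rewrite -!lt0n => vi; rewrite ltn_addr.
exists ((v - U_(i)) + w)%MM.
  have /eqP E : theta (w + (v - U_(i)))%MM ==
      theta ((U_(i) + U_(z)) + (v - U_(i)))%MM by rewrite thetaD Ew.
  apply/eqP; rewrite addmC E [(U_(i) + _)%MM]addmC -addmA [(U_(i) + _)%MM]addmC.
  by rewrite submK ?lep1mP // addmC thetaD Ev.
apply/hasP; exists j => //; rewrite mnmDE.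
by rewrite -lt0n ltn_addl // lt0n.
Qed.

Lemma colon_lideal W z W' : colon_step W z W' ->
  forall a, lideal A (xs W) (a * rho 'X_z) <-> lideal A (xs W') a.
Proof.
move=> colon a; have [f -> std_f] := standard_lift a.
have inj_f : {in msupp f &, injective theta}.
  by move=> u v /std_f su /std_f sv; exact: standard_inj.
have suppM u :
    (u \in msupp (f * 'X_z)) = (u \in [seq (v + U_(z))%MM | v <- msupp f]).
  have /perm_mem-> := msuppMX f U_(z)%MM.
  by congr (_ \in _); apply: eq_map => v; rewrite addmC.
rewrite -rmorphM !lideal_rhoP // => [|u v]; last first.
  rewrite !suppM => /mapP[u1 fu ->] /mapP[v1 fv ->] /eqP.
  by rewrite thetaD => /eqP/inj_f->.
split=> [H u fu|H u].
  by rewrite -(colon_monomial _ colon); apply: H; rewrite suppM; apply/mapP; exists u.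
by rewrite suppM => /mapP[v fv ->]; apply/(colon_monomial _ colon)/H.
Qed.

(** A family of lists of variables closed under prefixes and colons is a Koszul
    filtration of the quotient. *)
Theorem toric_koszul (adm : seq 'I_N -> Prop) (full : seq 'I_N) :
  (forall W z, adm (rcons W z) ->
    adm W /\ exists2 W', adm W' & colon_step W z W') ->
  adm full -> (forall i, i \in full) ->
  koszul quotient_gr.
Proof.
move=> admS adm_full fullP.
pose pi d : {additive A -> A} := component d.
apply: (@koszul_filtration A (fun s => exists2 W, adm W & s = xs W) quotient_gr
  pi _ _ _ _ _ _ (xs full)).
- exact: quotient_gr_component.
- exact: component_gr.
- exact: componentM1.
- by move=> _ [f hf ->]; exists (- f); rewrite ?rmorphN // dhomogN.
- move=> t l [W]; case/lastP: W => [|W z]; first by case: t.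
  move=> admWz; rewrite map_rcons => /rcons_inj[-> ->].
  have [admW [W' admW' colon]] := admS W z admWz.
  split; first by exists W.
    by exists 'X_z => //; rewrite dhomogX /= mdeg1.
  by exists (xs W'); [exists W' | exact: colon_lideal].
- by exists 1; rewrite ?rmorph1 //; exact: dhomog1.
- by exists full.
move=> a; split=> [[k [c [gr_c ->]]]|/lideal_lift[g -> gP]].
  elim/big_ind: _ => [||d _];
    [exact: (@lspan0 A A^o) | exact: (@lspanD A A^o) | ].
  have [f /dhomogP hf ->] := gr_c d; apply: lideal_rho => u /hf deg_u.
  exists u => //; apply: contra_eqT deg_u => /hasPn u0.
  rewrite /= mdegE big1 // => i _; apply/eqP; rewrite -[_ == _]negbK.
  exact: u0.
exists (msize g), (fun d => rho (pihomog mdeg d.+1 g)); split=> [d|].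
  by exists (pihomog mdeg d.+1 g) => //; exact: pihomogP.
rewrite -rmorph_sum {1}(pihomog_partitionE (leqnSn (msize g))) big_ord_recl /=.
rewrite pihomogE big1_seq ?add0r // => u /andP[/eqP deg_u /gP/hasP[i _]].
by move: deg_u => /= /eqP; rewrite mdeg_eq0 => /eqP->; rewrite mnm0E.
Qed.

End Quotient.
End Toric.

(** * Attaching the vertices of a tree *)

Section TreeOrder.
Variables (n m : nat) (G : sgraph n m).

(** A rooted tree with its vertices ranked so that they can be attached one by one:
    every vertex but the root is the upper endpoint [top i] of a single edge [i],
    whose lower endpoint [bot i] has smaller rank. *)
Record tree_order (rv : 'I_n -> nat) (root : 'I_n) (top bot : 'I_m -> 'I_n) :
    Prop := TreeOrder {
  tree_rank_inj : injective rv;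
  tree_edge : forall i, G i = [set top i; bot i];
  tree_lt : forall i, (rv (bot i) < rv (top i))%N;
  tree_top_inj : injective top;
  tree_top_root : forall i, top i != root;
  tree_topP : forall p, p != root -> exists i, p = top i
}.

Lemma adj_sym p q : adj G p q = adj G q p.
Proof. by apply: eq_existsb => i; rewrite setUC. Qed.

(** The connected pieces met while growing the tree from its root, listed in the
    order of attachment. *)
Definition grown (root : 'I_n) (vs : seq 'I_n) : Prop :=
  [/\ root \in vs, index root vs = 0%N, uniq vs & forall p, p \in vs -> p != root ->
    exists q, [/\ q \in vs, adj G q p & (index q vs < index p vs)%N]].

Lemma connect_exit (vs : seq 'I_n) p q : connect (adj G) p q ->
  p \in vs -> q \notin vs -> exists x y, [/\ x \in vs, y \notin vs & adj G x y].
Proof.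
case/connectP=> s; elim: s p => [|x s IHs] p /=; first by move=> _ -> ->.
move=> /andP[px xs] Eq vs_p nvs_q.
have [vs_x|nvs_x] := boolP (x \in vs); first exact: IHs vs_x nvs_q.
by exists p, x.
Qed.

Hypothesis treeG : is_tree G.

Lemma grown_all root : exists2 vs, grown root vs & forall p, p \in vs.
Proof.
have grow k : exists2 vs, grown root vs & (k <= size vs)%N \/ forall p, p \in vs.
  elim: k => [|k [vs [vs_r root0 uniq_vs vsP] [le_k|vs_all]]].
  - exists [:: root]; last by left.
    by split; rewrite ?mem_head //= ?eqxx // => p; rewrite inE => /eqP-> /eqP.
  - have [/forallP vs_all|] := boolP [forall p, p \in vs].
      by exists vs; [split | right].
    rewrite negb_forall => /existsP[q nvs_q]; have [_ conn _] := treeG.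
    have [x [y [vs_x nvs_y adj_xy]]] := connect_exit (conn root q) vs_r nvs_q.
    exists (rcons vs y); last by left; rewrite size_rcons ltnS.
    have idx z : z \in vs -> index z (rcons vs y) = index z vs.
      by move=> vs_z; rewrite -cats1 index_cat vs_z.
    split; rewrite ?mem_rcons ?inE ?vs_r ?orbT ?idx ?rcons_uniq ?nvs_y //.
    move=> p; rewrite mem_rcons inE => /predU1P[->{p}|vs_p] np.
      exists x; split; rewrite ?mem_rcons ?inE ?vs_x ?orbT // idx //.
      rewrite -cats1 index_cat (negPf nvs_y).
      by rewrite (leq_trans _ (leq_addr _ _)) ?index_mem.
    have [z [vs_z adj_zp lt_zp]] := vsP p vs_p np.
    by exists z; split; rewrite ?mem_rcons ?inE ?vs_z ?orbT // !idx.
  by exists vs; [split | right].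
have [vs gr_vs [lt_n|//]] := grow n.+1; last by exists vs.
have [_ _ uniq_vs _] := gr_vs.
by have := max_card (mem vs); rewrite (card_uniqP uniq_vs) card_ord leqNgt lt_n.
Qed.

(** The rank of a vertex is its position in the order of attachment.  Two edges
    with the same upper endpoint [t] would close a cycle: their distinct lower
    endpoints are joined by a path among the vertices of rank less than [t]. *)
Lemma tree_order_exists : exists rv root top bot, tree_order rv root top bot.
Proof.
have [n_gt0 _ acyclic] := treeG; pose root := Ordinal n_gt0.
have [vs [_ root0 _ vsP] vs_all] := grown_all root.
pose rv p := index p vs.
have rv_inj p q : rv p = rv q -> p = q.
  by move=> /(congr1 (nth root vs)); rewrite !nth_index.
have parent p : p != root -> exists2 q, adj G q p & (rv q < rv p)%N.
  by move=> /(vsP p (vs_all p))[q [_ ? ?]]; exists q.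
have /choice[tb tbP] i :
    exists tb, G i = [set tb.1; tb.2] /\ (rv tb.2 < rv tb.1)%N.
  have /eqP/cards2P[p [q [npq ->]]] := edge_card G i.
  case: (ltngtP (rv p) (rv q)) => [lt_pq|lt_qp|/rv_inj Epq].
  - by exists (q, p); split=> //=; rewrite setUC.
  - by exists (p, q).
  - by rewrite Epq eqxx in npq.
have top_inj : injective (fun i => (tb i).1).
  move=> i j /= Eij; apply/eqP/negPn/negP => nij.
  have [[Gi lt_i] [Gj lt_j]] := (tbP i, tbP j).
  set t := (tb i).1 in Eij Gi lt_i; rewrite -Eij in Gj lt_j.
  set a := (tb i).2 in Gi lt_i; set b := (tb j).2 in Gj lt_j.
  have nab : a != b.
    by apply: contra_neq nij => Eab; apply: (@edge_inj _ _ G); rewrite Gi Gj Eab.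
  pose e := [rel x y | [&& adj G x y, (rv x < rv t)%N & (rv y < rv t)%N]].
  have e_sym x y : e x y = e y x.
    by rewrite /= adj_sym; congr (_ && _); rewrite andbC.
  have to_root x : (rv x < rv t)%N -> connect e x root.
    move: {2}(rv x) (leqnn (rv x)) => k; elim/ltn_ind: k x => k IHk x le_k lt_x.
    have [->//|/parent[q adj_qx lt_q]] := eqVneq x root.
    apply: (connect_trans (y := q)); last first.
      exact: IHk (leq_trans lt_q le_k) _ (leqnn _) (ltn_trans lt_q lt_x).
    by apply: connect1; rewrite /= adj_sym adj_qx lt_x (ltn_trans lt_q).
  have /connectP[s0 es0 Eb] : connect e a b.
    by apply: connect_trans (to_root _ lt_i) _; rewrite sym_connect_sym // to_root.
  case/shortenP: es0 Eb => s es uniq_s _ Eb {s0}.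
  apply: (acyclic (t :: a :: s)) => /=.
    by case: s Eb {es uniq_s} => //= Eb; rewrite Eb eqxx in nab.
  have lt_s x : x \in a :: s -> (rv x < rv t)%N.
    rewrite inE => /predU1P[->//|]; elim: s (a) es {Eb uniq_s} => //= y s IHs z.
    by move=> /andP[/and3P[_ _ lt_y] /IHs es_s]; rewrite inE => /predU1P[->|/es_s].
  apply/andP; split; last first.
    rewrite /= in uniq_s *; rewrite uniq_s andbT.
    by apply/negP=> /lt_s; rewrite ltnn.
  rewrite /= rcons_path -Eb; apply/and3P; split.
  - by apply/existsP; exists i; rewrite Gi.
  - by apply: sub_path es => x y /andP[].
  - by apply/existsP; exists j; rewrite Gj setUC.
exists rv, root, (fun i => (tb i).1), (fun i => (tb i).2); split=> //.
- by move=> i; case: (tbP i).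
- by move=> i; case: (tbP i).
- by move=> i; apply/eqP=> Ei; have [_] := tbP i; rewrite Ei /rv root0.
move=> p /parent[q /existsP[i /eqP Gi] lt_qp]; exists i.
have [Gi' lt_i] := tbP i; rewrite Gi' in Gi.
have : p \in [set (tb i).1; (tb i).2] by rewrite Gi set22.
rewrite !inE => /orP[/eqP//|/eqP Ep]; move: lt_i; rewrite -Ep => lt_i.
have : (tb i).1 \in [set q; p] by rewrite -Gi set21.
rewrite !inE => /orP[/eqP Et|/eqP//].
by rewrite Et ltnNge ltnW in lt_i.
Qed.

End TreeOrder.

(** * The monomial map of the Rees algebra *)

Section Parametrization.
Variables (K : fieldType) (n m : nat) (G : sgraph n m).
Local Notation T := {mpoly K[n + m]}.
Local Notation x p := (lshift m p).
Local Notation y i := (rshift n i).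

(** The exponents of [x_1, ..., x_n] and of [t] in the image of a monomial. *)
Definition theta (u : 'X_{1..n + m}) : 'X_{1..n} * nat :=
  ([multinom (u (x p) + \sum_(i | p \notin G i) u (y i))%N | p < n],
   \sum_i u (y i))%N.

Lemma thetaE u v : theta (u + v)%MM =
  (((theta u).1 + (theta v).1)%MM, ((theta u).2 + (theta v).2)%N).
Proof.
congr (_, _) => /=; last first.
  by rewrite -big_split; apply: eq_bigr => i _; rewrite mnmDE.
apply/mnmP=> p; rewrite mnmDE !mnmE addnACA -big_split /=.
by congr (_ + _)%N; apply: eq_bigr => i _; rewrite mnmDE.
Qed.

Lemma thetaD u v w :
  (theta (u + w)%MM == theta (v + w)%MM) = (theta u == theta v).
Proof.
rewrite !thetaE xpair_eqE eqm_add2r eqn_add2r.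
by rewrite -xpair_eqE -!surjective_pairing.
Qed.

Lemma theta_deg u v : theta u = theta v -> mdeg u = mdeg v.
Proof.
have degE w : mdeg (theta w).1 =
    (\sum_p w (x p) + (theta w).2 * (n - 2))%N.
  rewrite mdegE; under eq_bigr => p _ do rewrite mnmE.
  rewrite big_split /= (exchange_big_dep xpredT) //= big_distrl /=.
  congr (_ + _)%N; apply: eq_bigr => i _; rewrite sum_nat_const mulnC.
  congr (_ * _)%N; transitivity #|~: G i|; last first.
    by rewrite cardsCs setCK edge_card card_ord.
  by apply: eq_card => p; rewrite !inE.
have degS w : mdeg w = (\sum_p w (x p) + (theta w).2)%N.
  by rewrite mdegE big_split_ord.
by move=> E; have := degE u; rewrite !degS E degE => /addIn->.
Qed.

Definition monomial_coef (w : 'X_{1..n} * nat) (f : T) : K :=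
  (phi G f)`_(w.2)@_(w.1).

Lemma monomial_coef_scalar w : scalar (monomial_coef w).
Proof.
move=> c f g; rewrite /monomial_coef rmorphD -mul_mpolyC rmorphM /=.
by rewrite phi_mpolyC coefD coefCM mcoeffD mcoeffCM.
Qed.

HB.instance Definition _ w :=
  GRing.isLinear.Build K T K *%R (monomial_coef w) (monomial_coef_scalar w).

Lemma phi_monomial u :
  phi G 'X_[u] = ('X_[K, (theta u).1])%:P * 'X^((theta u).2).
Proof.
rewrite /phi mmapX /mmap1 big_split_ord /=.
under eq_bigr => p _ do rewrite /phi_var (unsplitK (inl p)).
under [X in _ * X]eq_bigr => i _ do
  rewrite /phi_var (unsplitK (inr i)) exprMn.
rewrite big_split /= mulrA prodrXr; congr (_ * _).
under eq_bigr => p _ do rewrite -rmorphXn.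
under [X in _ * X]eq_bigr => i _ do rewrite -rmorphXn.
rewrite -!rmorph_prod -rmorphM; congr polyC.
rewrite [RHS]mpolyXE_id; under [RHS]eq_bigr => p _ do rewrite mnmE exprD -prodrXr.
rewrite big_split /= (exchange_big_dep xpredT) //=; congr (_ * _).
apply: eq_bigr => i _; rewrite /cgen prodrXl; congr (_ ^+ _); apply: eq_bigl => p.
by rewrite inE.
Qed.

Lemma monomial_coefX w u : monomial_coef w 'X_[u] = (theta u == w)%:R.
Proof.
rewrite /monomial_coef phi_monomial coefCM coefXn eq_sym.
rewrite -[theta u == w]/((_ == _) && (_ == _)) andbC.
by case: eqP => _; rewrite ?mulr1 ?mcoeffX ?mulr0 ?mcoeff0.
Qed.

Local Notation phiR := (@phiR K n m G).

Lemma phiR_zmod : zmod_morphism phiR.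
Proof. by move=> f g; apply: val_inj; rewrite rmorphB /= rmorphB. Qed.

Lemma phiR_monoid : monoid_morphism phiR.
Proof.
by split=> [|f g]; apply: val_inj; rewrite ?rmorphM ?rmorph1 /= ?rmorphM ?rmorph1.
Qed.

HB.instance Definition _ :=
  GRing.isZmodMorphism.Build T (cRees K G) phiR phiR_zmod.
HB.instance Definition _ :=
  GRing.isMonoidMorphism.Build T (cRees K G) phiR phiR_monoid.

Lemma phiR_ker f : phiR f = 0 <-> toric_ideal monomial_coef f.
Proof.
split=> [/(congr1 val) /= E w|E].
  by rewrite /= /monomial_coef E coef0 mcoeff0.
apply: val_inj => /=; apply/polyP=> d; apply/mpolyP=> a.
by rewrite coef0 mcoeff0; exact: (E (a, d)).
Qed.

(** [x_a y_i] maps to [(x_1 ... x_n / x_b) t] when the edge [i] joins [a] and [b]: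
    the image depends only on the vertex [b], whence the quadratic relations. *)
Lemma theta_edge i a b : a != b -> G i = [set a; b] ->
  theta (U_(x a) + U_(y i))%MM = ([multinom (b != q : nat) | q < n], 1%N).
Proof.
move=> nab Gi; congr (_, _) => /=.
  apply/mnmP=> q; rewrite !mnmE eq_lshift eq_rlshift addn0.
  rewrite (eq_bigr (fun j => nat_of_bool (i == j))) => [|j _]; last first.
    by rewrite mnmDE !mnm1E eq_lrshift eq_rshift.
  have -> : (\sum_(j | q \notin G j) (i == j) = (q \notin G i))%N.
    rewrite big_mkcond (bigD1 i) //= eqxx big1 => [|j nij]; last first.
      by rewrite eq_sym (negPf nij); case: (_ \notin _).
    by rewrite addn0; case: (_ \notin _).
  rewrite Gi !inE negb_or ![q == _]eq_sym.
  by case: (a =P q) => [<-|_] //; rewrite eq_sym nab.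
rewrite (bigD1 i) //= mnmDE !mnm1E eq_lrshift eqxx big1 // => j nij.
by rewrite mnmDE !mnm1E eq_lrshift eq_rshift eq_sym (negPf nij).
Qed.

End Parametrization.

(** * The rewriting rules and the Koszul filtration of a tree *)

Section TreeRules.
Variables (n m : nat) (G : sgraph n m).
Local Notation x p := (lshift m p).
Local Notation y i := (rshift n i).
Variables (rv : 'I_n -> nat) (root : 'I_n) (top bot : 'I_m -> 'I_n).
Hypothesis ord : tree_order G rv root top bot.
Local Notation rt i := (rv (top i)).

(** The pair [x_(top i)], [y_i] of variables belongs to the rank of the vertex that
    the edge [i] attaches. *)
Definition tree_rank (l : 'I_(n + m)) : nat :=
  match split l with inl p => rv p | inr i => rt i end.

(** Both [x_(top i) y_i] and [x_g y_j] have the image attached to the vertex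
    [bot i], and the second product consists of variables of lower rank. *)
Definition is_rule (t : 'I_m * 'I_m * 'I_n) : bool :=
  let: (i, j, g) := t in
  [&& G j == [set bot i; g], (rv g < rt i)%N & (rt j < rt i)%N].

Definition tree_rule (t : 'I_m * 'I_m * 'I_n) :
    ('I_(n + m) * 'I_(n + m)) * ('I_(n + m) * 'I_(n + m)) :=
  let: (i, j, g) := t in ((x (top i), y i), (x g, y j)).

Definition tree_rules := [seq tree_rule t | t <- enum is_rule].

Lemma tree_ruleP r : r \in tree_rules -> exists i j g,
  [/\ r = ((x (top i), y i), (x g, y j)), G j = [set bot i; g],
      (rv g < rt i)%N & (rt j < rt i)%N].
Proof.
case/mapP=> -[[i j] g]; rewrite mem_enum => /and3P[/eqP Gj lt_g lt_j] ->.
by exists i, j, g.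
Qed.

(** Every edge [i] but the lowest has a rule.  If [bot i] is not the root, it is
    attached by an edge [j'], and [g] is the lower endpoint of [j'].  Otherwise the
    lowest edge also contains the root, and serves with its upper endpoint. *)
Lemma tree_rule_exists i j : (rt j < rt i)%N -> exists j' g,
  (rt j' < rt i)%N /\ ((x (top i), y i), (x g, y j')) \in tree_rules.
Proof.
move=> lt_j; suff [j' [g r]] : exists j' g, is_rule (i, j', g).
  exists j', g; split; first by case/and3P: r.
  by apply/mapP; exists (i, j', g) => //; rewrite mem_enum.
have [Er|/(tree_topP ord)[j' Ej']] := eqVneq (bot i) root; last first.
  have lt_j' : (rt j' < rt i)%N by rewrite -Ej' (tree_lt ord).
  exists j', (bot j'); rewrite /is_rule Ej' (tree_edge ord) eqxx lt_j'.
  by rewrite (ltn_trans (tree_lt ord j')).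
have [j0 _ min_j0] := arg_minnP (fun k => rt k) (isT : xpredT j).
have lt_j0 : (rt j0 < rt i)%N by apply: leq_ltn_trans lt_j; exact: min_j0.
exists j0, (top j0); rewrite /is_rule lt_j0 andbT (tree_edge ord) setUC Er.
suff -> : bot j0 = root by rewrite eqxx.
apply/eqP/negPn/negP => /(tree_topP ord)[k Ek].
by have := min_j0 k isT; rewrite -Ek leqNgt (tree_lt ord).
Qed.

Lemma tree_rule_neq r : r \in tree_rules -> r.1.1 != r.1.2.
Proof. by case/tree_ruleP=> i [j [g [-> _ _ _]]] /=; rewrite eq_lrshift. Qed.

Lemma tree_rank_x p : tree_rank (x p) = rv p.
Proof. by rewrite /tree_rank (unsplitK (inl p)). Qed.

Lemma tree_rank_y i : tree_rank (y i) = rt i.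
Proof. by rewrite /tree_rank (unsplitK (inr i)). Qed.

Lemma tree_rule_rank r : r \in tree_rules ->
  (tree_rank r.2.1 + tree_rank r.2.2 < tree_rank r.1.1 + tree_rank r.1.2)%N.
Proof.
case/tree_ruleP=> i [j [g [-> _ lt_g lt_j]]] /=.
by rewrite !tree_rank_x !tree_rank_y; lia.
Qed.

Lemma top_neq_bot i : top i != bot i.
Proof. by apply: contraTneq (tree_lt ord i) => ->; rewrite ltnn. Qed.

Lemma tree_rule_theta r : r \in tree_rules ->
  theta G (U_(r.1.1) + U_(r.1.2))%MM = theta G (U_(r.2.1) + U_(r.2.2))%MM.
Proof.
case/tree_ruleP=> i [j [g [-> Gj _ _]]] /=.
rewrite (theta_edge (top_neq_bot i) (tree_edge ord i)).
rewrite setUC in Gj; rewrite (theta_edge _ Gj) //.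
by have := edge_card G j; rewrite Gj cards2; case: eqP.
Qed.

(** Since [theta] records the total degree in the [y_i] and, at every vertex [p],
    the exponent of [x_p] minus those of the [y_i] with [p] in the edge [i], the
    exponents can be recovered by descending rank.  At [top i] the exponents for
    the edges above are already known, hence so is the difference of the exponents
    of [x_(top i)] and [y_i]; as one of the two vanishes by standardness, both are
    known.  The total degree gives the exponent for the lowest edge, and the
    vertices give those of the remaining [x_p]. *)
Lemma tree_standard_inj u v : standard tree_rules u -> standard tree_rules v ->
  theta G u = theta G v -> u = v.
Proof.
move=> std_u std_v E.
have Ex p : (theta G u).1 p = (theta G v).1 p by rewrite E.
have Ey : (\sum_i u (y i) = \sum_i v (y i))%N by case: E.
have vertexE p : (u (x p) + \sum_(i | p \in G i) v (y i) =
                  v (x p) + \sum_(i | p \in G i) u (y i))%N.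
  have := Ex p; rewrite !mnmE; move: Ey.
  rewrite (bigID (fun i => p \in G i)) [in RHS](bigID (fun i => p \in G i)) /=.
  by lia.
have nonmin i j : (rt j < rt i)%N -> u (y i) = v (y i).
  (* [M - rt i] turns the descent on the rank into an induction. *)
  pose M := (\sum_k rt k)%N.
  have le_M k : (rt k <= M)%N by rewrite /M (bigD1 k) //= leq_addr.
  move: {2}(M - rt i)%N (leqnn (M - rt i)%N) => k.
  elim/ltn_ind: k i j => k IHk i j le_k lt_j.
  have := vertexE (top i).
  have Gi : top i \in G i by rewrite (tree_edge ord) set21.
  rewrite (bigD1 i) //= [in X in _ = X](bigD1 i) //=.
  rewrite [X in (_ + (_ + X) = _)%N](eq_bigr (fun i' => u (y i'))); last first.
    move=> i' /andP[]; rewrite (tree_edge ord) !inE => /orP[/eqP|/eqP Ei' ni'].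
      by move/(tree_top_inj ord)->; rewrite eqxx.
    have lt_i' := tree_lt ord i'; rewrite -Ei' in lt_i'.
    by apply/esym; apply: (IHk (M - rt i')%N _ i' i) => //; have := le_M i'; lia.
  have [j' [g [_ rule_i]]] := tree_rule_exists lt_j.
  have := allP std_u _ rule_i; have := allP std_v _ rule_i => /=.
  by move=> /orP[]/eqP ? /orP[]/eqP ? ?; lia.
have Eyi i : u (y i) = v (y i).
  have [/existsP[j lt_j]|/existsPn min_i] := boolP [exists j, (rt j < rt i)%N].
    exact: nonmin lt_j.
  move: Ey; rewrite (bigD1 i) //= [in RHS](bigD1 i) //=.
  rewrite [X in (_ + X = _)%N](eq_bigr (fun j => v (y j))) => [|j nij].
    by move/addIn.
  apply: (nonmin j i); rewrite ltn_neqAle leqNgt min_i andbT.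
  by apply: contra_neq nij => /(tree_rank_inj ord)/(tree_top_inj ord).
apply/mnmP=> l; rewrite -(splitK l); case: (split l) => [p|i] /=; last exact: Eyi.
by have := vertexE p; rewrite (eq_bigr (fun i => u (y i))) // => /addIn.
Qed.

Definition edges_by_rank : seq 'I_m :=
  sort (fun i j => rt i <= rt j)%N (enum 'I_m).

Lemma edges_prefix s s' i j : edges_by_rank = s ++ s' ->
  i \in s -> (rt j < rt i)%N -> j \in s.
Proof.
move=> Es s_i lt_j; have : j \in edges_by_rank by rewrite mem_sort mem_enum.
rewrite Es mem_cat => /orP[//|s'_j].
have : sorted (fun i j => rt i <= rt j)%N edges_by_rank.
  by apply: sort_sorted => k l; exact: leq_total.
rewrite sorted_pairwise => [|k l k']; last exact: leq_trans.
rewrite Es pairwise_cat => /andP[/allrelP/(_ i j s_i s'_j)].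
by rewrite leqNgt lt_j.
Qed.

Lemma edges_uniq : uniq edges_by_rank.
Proof. by rewrite sort_uniq enum_uniq. Qed.

Definition edge_vars (s : seq 'I_m) : seq 'I_(n + m) :=
  foldl (fun W e => rcons (rcons W (x (top e))) (y e)) [:: x root] s.

Lemma edge_vars_rcons s e :
  edge_vars (rcons s e) = rcons (rcons (edge_vars s) (x (top e))) (y e).
Proof. exact: foldl_rcons. Qed.

Lemma in_rcons (T : eqType) (W : seq T) (z l : T) :
  (l \in rcons W z) = (l == z) || (l \in W).
Proof. by rewrite mem_rcons in_cons. Qed.

Lemma edge_vars_top s i : (x (top i) \in edge_vars s) = (i \in s).
Proof.
elim/last_ind: s => [|s e IHs].
  by rewrite inE eq_lshift (negPf (tree_top_root ord i)).
rewrite edge_vars_rcons !in_rcons IHs eq_lrshift eq_lshift.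
by rewrite (inj_eq (tree_top_inj ord)).
Qed.

Lemma edge_vars_y s i : (y i \in edge_vars s) = (i \in s).
Proof.
elim/last_ind: s => [|s e IHs]; first by rewrite inE eq_rlshift.
by rewrite edge_vars_rcons !in_rcons IHs eq_rlshift eq_rshift.
Qed.

(** The Koszul filtration: the variables of the tree grown up to some edge, with
    possibly one of the two variables [x_(top e)], [y_e] of the next edge [e]. *)
Definition tree_adm (W : seq 'I_(n + m)) : Prop :=
  [\/ W = [::], exists s s', edges_by_rank = s ++ s' /\ W = edge_vars s
    | exists s e s', edges_by_rank = s ++ e :: s' /\
        (W = rcons (edge_vars s) (x (top e)) \/ W = rcons (edge_vars s) (y e))].

Local Notation in_ideal := (in_ideal (theta G)).
Local Notation colon_step := (colon_step (theta G) tree_rules).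

(** A rule rewrites into lower rank, so initial segments are closed. *)
Lemma edge_vars_closed s s' : edges_by_rank = s ++ s' ->
  rule_closed tree_rules (edge_vars s).
Proof.
move=> Es r /tree_ruleP[i [j [g [-> _ _ lt_j]]]] /=.
rewrite edge_vars_top edge_vars_y orbb => s_i.
by rewrite edge_vars_y (edges_prefix Es s_i lt_j) orbT.
Qed.

Lemma edge_vars_top_closed s e s' : edges_by_rank = s ++ e :: s' ->
  rule_closed tree_rules (rcons (edge_vars s) (x (top e))).
Proof.
move=> Es r /tree_ruleP[i [j [g [-> _ _ lt_j]]]] /=.
rewrite !in_rcons edge_vars_top !edge_vars_y eq_lshift !eq_rlshift /=.
rewrite (inj_eq (tree_top_inj ord)) => s_i.
have : j \in rcons s e.
  apply: edges_prefix lt_j; first by rewrite Es -cat_rcons.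
  by rewrite in_rcons; case/orP: s_i => ->; rewrite ?orbT.
rewrite in_rcons => /predU1P[Eje|->]; last by rewrite orbT.
case/orP: s_i => [/orP[/eqP Eie|s_i]|s_i].
- by rewrite Eie Eje ltnn in lt_j.
- by rewrite (edges_prefix Es s_i lt_j) orbT.
- by rewrite (edges_prefix Es s_i lt_j) orbT.
Qed.

Lemma edge_notin s e s' : edges_by_rank = s ++ e :: s' -> e \notin s.
Proof.
move=> Es; have := edges_uniq; rewrite Es cat_uniq => /and3P[_ /hasPn H _].
by apply: H; rewrite mem_head.
Qed.

(** The next edge [e] has a rule as soon as some edge precedes it; [z z'] then lies
    in the ideal of [edge_vars s], and the colon by [z] acquires [z'].  For the lowest
    edge, both variables are regular modulo the root variable. *)
Lemma colon_edge s e s' z z' : edges_by_rank = s ++ e :: s' ->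
  (z = x (top e) /\ z' = y e) \/ (z = y e /\ z' = x (top e)) ->
  exists2 W', W' = edge_vars s \/ W' = rcons (edge_vars s) z' &
    colon_step (edge_vars s) z W'.
Proof.
move=> Es Ezz'; have nse := edge_notin Es; have clW := edge_vars_closed Es.
have nz : z \notin edge_vars s.
  by case: Ezz' => -[-> _]; rewrite ?edge_vars_top ?edge_vars_y.
have zE i : (x (top i) = z -> i = e) /\ (y i = z -> i = e).
  split; case: Ezz' => -[-> _] /eqP;
    rewrite ?eq_lshift ?eq_rshift ?eq_lrshift ?eq_rlshift // => /eqP //.
  by move/(tree_top_inj ord).
have [s0|[i0 s_i0]] : s = [::] \/ exists i0, i0 \in s.
  by case: (s) => [|i0 s0]; [left | right; exists i0; rewrite mem_head].
- exists (edge_vars s); [by left | split=> // [r|i Wi]; last by left].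
  move=> /tree_ruleP[i [j [g [-> _ _ lt_j]]]] /=.
  have [zx zy] := zE i; suff nie : i <> e by split=> [/zx|/zy].
  move=> Ei; rewrite Ei in lt_j.
  have : j \in rcons s e.
    apply: edges_prefix lt_j; first by rewrite Es -cat_rcons.
    by rewrite mem_rcons mem_head.
  by rewrite s0 inE => /eqP Ej; rewrite Ej ltnn in lt_j.
have lt_i0 : (rt i0 < rt e)%N.
  rewrite ltnNge; apply/negP=> le_e.
  have nei0 : e != i0 by apply: contraNneq nse => ->.
  suff: e \in s by rewrite (negPf nse).
  apply: (edges_prefix Es s_i0); rewrite ltn_neqAle le_e andbT.
  by apply: contra_neq nei0 => /(tree_rank_inj ord)/(tree_top_inj ord).
exists (rcons (edge_vars s) z'); first by right.
split=> // [l Wl|r|l].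
- by rewrite in_rcons Wl orbT.
- move=> /tree_ruleP[i [j [g [-> _ _ lt_j]]]] /=; have [zx zy] := zE i.
  by case: Ezz' => -[Ez ->]; split=> Ei; rewrite ?(zx Ei) ?(zy Ei) in_rcons ?eqxx //;
    move: Ei; rewrite Ez => /eqP; rewrite ?eq_lrshift ?eq_rlshift.
rewrite in_rcons => /predU1P[->|]; [right | by left].
have [j [g [lt_j rule_e]]] := tree_rule_exists lt_i0.
exists (U_(x g) + U_(y j))%MM.
  rewrite -(tree_rule_theta rule_e) /=.
  by case: Ezz' => -[-> ->] //; rewrite addmC.
apply/hasP; exists (y j); last by rewrite mnmDE !mnm1E eqxx addn1.
rewrite edge_vars_y; have : j \in rcons s e.
  apply: edges_prefix lt_j; first by rewrite Es -cat_rcons.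
  by rewrite mem_rcons mem_head.
by rewrite in_rcons => /predU1P[Ej|//]; rewrite Ej ltnn in lt_j.
Qed.

Lemma colon_top_y s e s' : edges_by_rank = s ++ e :: s' ->
  colon_step (rcons (edge_vars s) (x (top e))) (y e)
             (rcons (edge_vars s) (x (top e))).
Proof.
move=> Es; split=> // [||r|]; last by left.
- exact: edge_vars_top_closed Es.
- by rewrite in_rcons eq_rlshift edge_vars_y (negPf (edge_notin Es)).
move=> /tree_ruleP[i [j [g [-> _ _ lt_j]]]] /=; split=> /eqP.
  by rewrite eq_lrshift.
by rewrite eq_rshift => /eqP->; rewrite mem_rcons mem_head.
Qed.

Lemma colon_root : colon_step [::] (x root) [::].
Proof.
split=> // r /tree_ruleP[i [j [g [-> _ _ _]]]] /=; split=> /eqP.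
  by rewrite eq_lshift (negPf (tree_top_root ord i)).
by rewrite eq_rlshift.
Qed.

Lemma tree_adm_step W z : tree_adm (rcons W z) ->
  tree_adm W /\ exists2 W', tree_adm W' & colon_step W z W'.
Proof.
have adm_first s e s' z0 z' : edges_by_rank = s ++ e :: s' ->
    (z0 = x (top e) /\ z' = y e) \/ (z0 = y e /\ z' = x (top e)) ->
    tree_adm (edge_vars s) /\
      exists2 W', tree_adm W' & colon_step (edge_vars s) z0 W'.
  move=> Es Ez; have admW : tree_adm (edge_vars s).
    by apply: Or32; exists s, (e :: s').
  have [W' EW' colon] := colon_edge Es Ez.
  split=> //; exists W' => //; case: EW' => -> //; apply: Or33; exists s, e, s'.
  by split=> //; case: Ez => -[_ ->]; [right | left].
case=> [|[s [s' [Es EW]]]|[s [e [s' [Es EW]]]]]; first by case: W.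
  case/lastP: s => [|s e] in Es EW.
    have [-> ->] : (W, z) = ([::], x root) by exact: rcons_inj.
    have adm0 : tree_adm [::] by apply: Or31.
    by split=> //; exists [::] => //; exact: colon_root.
  rewrite edge_vars_rcons in EW; rewrite cat_rcons in Es.
  have [-> ->] := rcons_inj EW.
  have admW : tree_adm (rcons (edge_vars s) (x (top e))).
    by apply: Or33; exists s, e, s'; split=> //; left.
  by split=> //; eexists; [exact: admW | exact: colon_top_y Es].
by case: EW => /rcons_inj[-> ->]; apply: adm_first Es _; [left | right].
Qed.

Lemma edge_vars_full l : l \in edge_vars edges_by_rank.
Proof.
have all_e i : i \in edges_by_rank by rewrite mem_sort mem_enum.
rewrite -(splitK l); case: (split l) => [p|i] /=; last by rewrite edge_vars_y.
have [->|/(tree_topP ord)[i ->]] := eqVneq p root; last by rewrite edge_vars_top.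
elim/last_ind: edges_by_rank => [|s e IHs]; first exact: mem_head.
by rewrite edge_vars_rcons !in_rcons IHs !orbT.
Qed.

End TreeRules.

(** * Rees algebras of trees *)

Theorem theorem2p2 (K : fieldType) (n m : nat) (G : sgraph n m)
    (treeG : is_tree G) :
  (exists2 r : rel 'X_{1..n + m},
     monomial_order r
     & has_quadratic_groebner_basis r (@defining_ideal K n m G))
  /\ koszul (@cRees_gr K n m G).
Proof.
have [rv [root [top [bot ord]]]] := tree_order_exists treeG.
have EJ : @defining_ideal K n m G = toric_ideal (@monomial_coef K n m G).
  by apply/funext => f; apply/propext; exact: phiR_ker.
pose rank := tree_rank rv top; split.
  exists (wle rank); first exact: wle_monomial_order.
  rewrite EJ; apply: (@toric_quadratic_groebner K (n + m) _ (theta G) (@thetaD n m G)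
    (@monomial_coef K n m G) _ (tree_rules G rv top bot)).
  - exact: monomial_coefX.
  - exact: tree_rule_neq.
  - exact: tree_rule_theta ord.
  - exact: tree_rule_rank.
  - exact: tree_standard_inj ord.
apply: (@toric_koszul K (n + m) _ (theta G) (@thetaD n m G) (@theta_deg n m G)
  (@monomial_coef K n m G) (@monomial_coefX K n m G)
  (tree_rules G rv top bot) rank _ _ _ _ (cRees K G) (@phiR K n m G) _ _
  (tree_adm rv root top) (edge_vars root top (edges_by_rank rv top))).
- exact: tree_rule_neq.
- exact: tree_rule_theta ord.
- exact: tree_rule_rank.
- exact: tree_standard_inj ord.
- exact: phiR_surj.
- exact: phiR_ker.
- exact: tree_adm_step ord.
- by apply: Or32; exists (edges_by_rank rv top), [::]; rewrite cats0.
- exact: edge_vars_full ord.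
Qed.
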